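(* (Maximum principle.) Let $\Omega$ be a subgraph of a host graph $G=(V,E)$ with $\partial\Omega\ne\emptyset$, let $b,c:V\to\mathbb{R}$ satisfy $b(x)\ge 0$ and $c(x)>0$ for all $x\in V$, and let $\mathcal{B}u=u$ or $\mathcal{B}u=\frac{\partial u}{\partial_\Omega n}$. Suppose $u:\overline{\Omega}\to\mathbb{R}$ satisfies $$-\Delta_\Omega u-\vec{b}\cdot\nabla u+c(x)u\ge 0\ \text{ in }\Omega,\qquad \mathcal{B}u\ge 0\ \text{ on }\partial\Omega.$$ Then $u(x)\ge 0$ for all $x\in\overline{\Omega}$.
   Context: The host graph $G=(V,E)$ is finite, undirected and connected, with weight $\omega:V\times V\to[0,\infty)$, $\omega_{xy}=\omega_{yx}$, $\omega_{xy}=0$ iff $xy\notin E$, and measure $\mu:V\to(0,\infty)$. $\Omega$ is a connected, simple, induced subgraph (identified with its vertex set); $\partial\Omega=\{z\in V\setminus\Omega: z\sim y\text{ for some }y\in\Omega\}$ and $\overline{\Omega}=\Omega\cup\partial\Omega$. For $x\in\Omega$, $\Delta_\Omega u(x)=\sum_{y\in\overline{\Omega}}(u(y)-u(x))\frac{\omega_{yx}}{\mu(x)}$. For $z\in\partial\Omega$, $\frac{\partial u}{\partial_\Omega n}(z)=\sum_{y\in\Omega}(u(z)-u(y))\frac{\omega_{zy}}{\mu(z)}$. With $\vec b=(b(x))_{x\in V}$ and $\nabla u(x)=\big((u(y)-u(x))\sqrt{\omega_{xy}/(2\mu(x))}\big)_{y\sim x}$, one sets, for $x\in\Omega$, $(\vec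 b\cdot\nabla u)(x)=\sum_{y\sim x}b(y)(u(y)-u(x))\sqrt{\frac{\omega_{xy}}{2\mu(x)}}$. *)

(* Defs.v *)
From mathcomp Require Import all_boot all_order all_algebra.
From mathcomp Require Import reals.

Set Implicit Arguments.
Unset Strict Implicit.
Unset Printing Implicit Defensive.

Import Order.TTheory GRing.Theory Num.Theory.

Local Open Scope ring_scope.

(* Loops are not excluded in the host graph; simplicity is required of the
   subgraph Omega only, see [simple_in]. *)
Record hostGraph (R : realType) := HostGraph {
  vertex :> finType;
  adj : rel vertex;
  adj_sym : symmetric adj;
  adj_connected : forall x y : vertex, connect adj x y;
  weight : vertex -> vertex -> R;
  weight_ge0 : forall x y, 0 <= weight x y;
  weight_sym : forall x y, weight x y = weight y x;
  weight_eq0 : forall x y, weight x y = 0 <-> ~~ adj x y;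
  measure : vertex -> R;
  measure_gt0 : forall x, 0 < measure x }.

Section Operators.

Variables (R : realType) (G : hostGraph R).

(* An induced subgraph is identified with its vertex set. *)
Implicit Types (Omega : {set G}) (b u : G -> R) (x y z : G).

Definition induced_adj Omega : rel G :=
  [rel x y | [&& x \in Omega, y \in Omega & adj x y]].

Definition connected_in Omega : Prop :=
  {in Omega &, forall x y, connect (induced_adj Omega) x y}.

(* Multiple edges cannot occur, as [adj] is a relation. *)
Definition simple_in Omega : Prop := {in Omega, forall x, ~~ adj x x}.

Definition boundary Omega : {set G} :=
  [set z | (z \notin Omega) && [exists y in Omega, adj z y]].

Definition domain_closure Omega : {set G} := Omega :|: boundary Omega.

(* Functions on the closure of Omega are represented by functions u on all
   of G. For x in Omega every neighbour of x is in the closure, so at the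
   points of the closure where the operators below are considered, they do not
   depend on the values of u outside the closure. *)

Definition laplacian Omega u x : R :=
  \sum_(y in domain_closure Omega) (u y - u x) * (weight y x / measure x).

Definition normal_derivative Omega u z : R :=
  \sum_(y in Omega) (u z - u y) * (weight z y / measure z).

(* Component of the gradient of u at x along the edge from x to y; it is only
   used for y adjacent to x. *)
Definition gradient u x y : R :=
  (u y - u x) * Num.sqrt (weight x y / (2 * measure x)).

Definition drift b u x : R := \sum_(y | adj x y) b y * gradient u x y.

End Operators.

(* Main.v *)
Require Import Defs.
From mathcomp Require Import all_boot all_order all_algebra.
From mathcomp Require Import reals.

Set Implicit Arguments.
Unset Strict Implicit.
Unset Printing Implicit Defensive.

Import Order.TTheory GRing.Theory Num.Theory.

Local Open Scope ring_scope.

(** The argument looks only at a minimum point m of u over the closure of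
    Omega, and shows that u is nonnegative at some minimum point.

    If m is interior, every difference u y - u m with y adjacent to m is
    nonnegative, because all neighbours of m lie in the closure; the Laplacian
    and, as b is nonnegative, the drift are then both nonnegative at m. The
    differential inequality leaves c m * u m nonnegative, and c m > 0 gives the
    sign of u m ([supersolution_ge0_at_min]).

    If m is on the boundary, the Dirichlet condition is the claim itself. Under
    the Neumann condition, the terms of the normal derivative at m are all
    nonpositive while their sum is nonnegative, so they all vanish; a neighbour
    of m in Omega therefore attains the same minimum, which reduces to the
    interior case ([interior_min_of_normal_derivative_ge0]). *)

Section MinimumPoints.

Variables (R : realType) (G : hostGraph R) (Omega : {set G}).

Lemma weight_gt0 (x y : G) : adj x y -> 0 < weight x y.
Proof.
move=> xy; rewrite lt_def weight_ge0 andbT; apply/eqP => w0.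
by move/weight_eq0: w0; rewrite xy.
Qed.

Lemma adj_closure (x y : G) :
  x \in Omega -> adj x y -> y \in domain_closure Omega.
Proof.
move=> xO xy; rewrite !inE; case: (boolP (y \in Omega)) => //= yNO.
by apply/existsP; exists x; rewrite xO adj_sym.
Qed.

Variables (u : G -> R) (m : G).
Hypothesis m_min : {in domain_closure Omega, forall y, u m <= u y}.

Lemma laplacian_ge0_at_min : 0 <= laplacian Omega u m.
Proof.
apply: sumr_ge0 => y yO; rewrite mulr_ge0 ?subr_ge0 ?m_min//.
by rewrite divr_ge0 ?weight_ge0// ltW// measure_gt0.
Qed.

(** Unlike the Laplacian, the drift sums over all neighbours in the host graph,
    so m has to be interior for minimality over the closure to apply. *)
Lemma drift_ge0_at_min (b : G -> R) :
  (forall x, 0 <= b x) -> m \in Omega -> 0 <= drift b u m.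
Proof.
move=> b_ge0 mO; apply: sumr_ge0 => y my.
rewrite mulr_ge0// mulr_ge0 ?sqrtr_ge0// subr_ge0.
exact/m_min/(adj_closure mO).
Qed.

Lemma supersolution_ge0_at_min (b c : G -> R) :
    (forall x, 0 <= b x) -> 0 < c m -> m \in Omega ->
    0 <= - laplacian Omega u m - drift b u m + c m * u m ->
  0 <= u m.
Proof.
move=> b_ge0 cm_gt0 mO; rewrite -opprD addrC subr_ge0 => le_cu.
rewrite -(pmulr_rge0 _ cm_gt0); apply: le_trans le_cu.
by rewrite addr_ge0 ?laplacian_ge0_at_min ?drift_ge0_at_min.
Qed.

(** An elementary form of the Hopf lemma: a nonnegative outward derivative at a
    boundary minimum forces the minimum to be attained inside as well. *)
Lemma interior_min_of_normal_derivative_ge0 :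
    m \in boundary Omega -> 0 <= normal_derivative Omega u m ->
  exists2 y, y \in Omega & u y = u m.
Proof.
rewrite inE => /andP[_ /existsP[y /andP[yO my]]] dn_ge0; exists y => //.
pose F z := (u z - u m) * (weight m z / measure m).
have F_ge0 z : z \in Omega -> 0 <= F z.
  move=> zO; rewrite mulr_ge0 ?subr_ge0 ?m_min//; first by rewrite inE zO.
  by rewrite divr_ge0 ?weight_ge0// ltW// measure_gt0.
have sumF0 : \sum_(z in Omega) F z = 0.
  apply/eqP; rewrite eq_le sumr_ge0// andbT -oppr_ge0 -sumrN.
  by under eq_bigr do rewrite -mulNr opprB.
(* The edge from m to y has positive weight, so only the difference can vanish. *)
have coef_gt0 : 0 < weight m y / measure m.
  by rewrite divr_gt0 ?weight_gt0 ?measure_gt0.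
have /eqP := psumr_eq0P F_ge0 sumF0 yO.
by rewrite mulf_eq0 subr_eq0 (gt_eqF coef_gt0) orbF => /eqP.
Qed.

End MinimumPoints.

Theorem theorem3p8 (R : realType) (G : hostGraph R) (Omega : {set G})
    (Omega_connected : connected_in Omega) (Omega_simple : simple_in Omega)
    (boundary_neq0 : boundary Omega != set0)
    (b c : G -> R)
    (b_ge0 : forall x, 0 <= b x) (c_gt0 : forall x, 0 < c x)
    (B : (G -> R) -> (G -> R))
    (hB : B = (fun u => u) \/ B = normal_derivative Omega)
    (u : G -> R)
    (u_super : forall x, x \in Omega ->
       0 <= - laplacian Omega u x - drift b u x + c x * u x)
    (u_boundary : forall z, z \in boundary Omega -> 0 <= B u z) :
  forall x, x \in domain_closure Omega -> 0 <= u x.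
Proof.
move=> x xO.
case: (arg_minP u xO) => m mO m_min.
apply: le_trans (m_min x xO).
have interior y : y \in Omega -> u y = u m -> 0 <= u y.
  move=> yO uy; apply: supersolution_ge0_at_min (u_super y yO) => //.
  by rewrite uy; exact: m_min.
case/setUP: mO => [mOmega|mB]; first exact: interior.
have := u_boundary m mB; case: hB => -> // dn_ge0.
have [y yO uy] := interior_min_of_normal_derivative_ge0 m_min mB dn_ge0.
by rewrite -uy; exact: interior.
Qed.
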